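(* Consider the finite-horizon adaptive robust decision problem $$\max_{a_1\in\mathcal{A}}\min_{(p_1,r_1)\in\mathcal{U}_{s_1}}\max_{a_2\in\mathcal{A}}\min_{(p_2,r_2)\in\mathcal{U}_{s_2}}\cdots\max_{a_T\in\mathcal{A}}\min_{(p_T,r_T)\in\mathcal{U}_{s_T}}\mathbb{E}\Big\{\sum_{t=1}^{T}r_t(s_t,a_t)\Big\}\quad\text{subject to}\quad\sum_{t=1}^{T}\mathbf{1}_{(p_t,r_t)\neq(p_t^0,r_t^0)}\le D,$$ where $T<\infty$ and $D$ is a non-negative integer. Let $v_{T+1}(s,d)=0$ for all $s\in\mathcal{S}$ and $d\in\{0,1,\dots,D\}$, and for $t=T,T-1,\dots,1$ let $$q_t(s,d,a,p,r)=\sum_{s'\in\mathcal{S}}p(s'\mid s,a)\,v_{t+1}(s',d)+r(s,a),$$ $$v_t(s,d)=\begin{cases}\max_{a\in\mathcal{A}}\Big\{\min\Big[q_t(s,d,a,p_s^0,r_s^0),\ \min_{(p,r)\in\mathcal{U}_s}q_t(s,d-1,a,p,r)\Big]\Big\},& d\ge1,\\[2mm]\max_{a\in\mathcal{A}}q_t(s,d,a,p_s^0,r_s^0),& d=0,\end{cases}$$ and let $a_t^*(s,d)$ be an action attaining the maximum over $a\in\mathcal{A}$ in the definition of $v_t(s,d)$, i.e. $$a_t^*(s,d)\in\begin{cases}\arg\max_{a\in\mathcal{A}}\Big\{\min\Big[q_t(s,d,a,p_s^0,r_s^0),\ \min_{(p,r)\in\mathcal{U}_s}q_t(s,d-1,a,p,r)\Big]\Big\},&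 d\ge1,\\[2mm]\arg\max_{a\in\mathcal{A}}q_t(s,d,a,p_s^0,r_s^0),& d=0.\end{cases}$$ Then the optimal strategy for the finite-horizon adaptive robust decision problem of maximizing over $a_1$, minimizing over $(p_1,r_1)\in\mathcal{U}_{s_1}$, and so on alternately through stage $T$, the expected total reward $\mathbb{E}\{\sum_{t=1}^{T}r_t(s_t,a_t)\}$ subject to $\sum_{t=1}^{T}\mathbf{1}_{(p_t,r_t)\neq(p_t^0,r_t^0)}\le D$, is to take action $a_t^*(s,d)$ at stage $t$ in state $s$, where $d$ is the number of times stage-parameters are still allowed to deviate from this stage on (i.e. $D$ minus the number of stages before $t$ at which the parameters deviated).
   Context: $\mathcal{S}$ and $\mathcal{A}$ are finite state and action spaces; there is no discounting. For each state $s$, $p_s=(p(\cdot\mid s,a))_{a\in\mathcal{A}}$ are transition probabilities and $r_s=(r(s,a))_{a\in\mathcal{A}}$ rewards, with nominal values $(p_s^0,r_s^0)$ lying in a convex uncertainty set $\mathcal{U}_s$ of possible values of $(p_s,r_s)$. As the notation $\min$ presupposes, the minima over $\mathcal{U}_s$ are attained. The problem is a sequential game with perfect information between the decision maker (maximizing) and Nature (minimizing). At each stage $t=1,\dots,T$, the system is in state $s_t$; the decision maker, knowing the whole history (past states, past actions, and past realized parameters, hence past deviations), chooses $a_t\in\mathcal{A}$; then Nature, knowing the history and $a_t$, chooses $(p_t,r_t)\in\mathcal{U}_{s_t}$; the decision maker observes $(p_t,r_t)$ and receives $r_t(s_t,a_t)$; the next state satisfies $\Pr(s_{t+1}=s'\mid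 s_t=s,a_t)=p_t(s'\mid s,a_t)$. Here $(p_t^0,r_t^0)=(p_{s_t}^0,r_{s_t}^0)$. Nature's choices must satisfy the constraint that, along every trajectory, the number of stages $t$ with $(p_t,r_t)\neq(p_t^0,r_t^0)$ is at most $D$; the parameters of one state may take different values at different visits. A strategy of the decision maker is optimal if it maximizes the worst-case (over Nature's admissible strategies) expected total reward, i.e. attains the nested max-min value. *)

(* Defs.v *)
From mathcomp Require Export all_boot all_order all_algebra.
From mathcomp Require Export all_classical all_reals all_analysis.
Set Implicit Arguments.
Unset Strict Implicit.
Unset Printing Implicit Defensive.
Import Order.TTheory GRing.Theory Num.Theory.
Local Open Scope classical_set_scope.
Local Open Scope ring_scope.

(* A value of (p_s, r_s): [u.1 a s'] is p(s' | s, a) and [u.2 a] is r(s, a).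
   Finite functions make equality of parameters (hence "deviation") that of
   the whole vectors; [R^o] is R as a module over itself, which makes the type
   an R-module, as needed for convexity. *)
Definition param (R : realType) (S A : finType) : Type :=
  ({ffun A -> {ffun S -> R^o}} * {ffun A -> R^o})%type.

Definition trans (R : realType) (S A : finType) (u : param R S A)
  (a : A) (s' : S) : R := u.1 a s'.

Definition reward (R : realType) (S A : finType) (u : param R S A)
  (a : A) : R := u.2 a.

Definition stochastic (R : realType) (S A : finType) (u : param R S A) : Prop :=
  forall a : A, (forall s' : S, 0 <= trans u a s') /\
                \sum_(s' : S) trans u a s' = 1.

Definition convex_params (R : realType) (S A : finType)
    (E : set (param R S A)) : Prop :=
  convex_set (E : set (convex_lmodType
    (({ffun A -> {ffun S -> R^o}} * {ffun A -> R^o})%type : lmodType R))).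

Record stage (R : realType) (S A : finType) := Stage {
  stage_state : S;
  stage_action : A;
  stage_param : param R S A
}.

(* Completed stages, oldest first: the current stage is [(size h).+1]. *)
Definition history (R : realType) (S A : finType) := seq (stage R S A).

Definition dm_strategy (R : realType) (S A : finType) :=
  history R S A -> S -> A.

Definition nature_strategy (R : realType) (S A : finType) :=
  history R S A -> S -> A -> param R S A.

Definition deviations (R : realType) (S A : finType) (nom : S -> param R S A)
    (h : history R S A) : nat :=
  count (fun x => stage_param x != nom (stage_state x)) h.

Definition total_reward (R : realType) (S A : finType)
    (h : history R S A) : R :=
  \sum_(x <- h) reward (stage_param x) (stage_action x).

Definition play_stage (R : realType) (S A : finType)
    (pi : dm_strategy R S A) (nu : nature_strategy R S A)
    (h : history R S A) (s : S) : stage R S A :=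
  Stage s (pi h s) (nu h s (pi h s)).

(* From history [h] and current state [s], [w] lists the successive next
   states; the last one is the state reached after the final stage. *)
Fixpoint play (R : realType) (S A : finType)
    (pi : dm_strategy R S A) (nu : nature_strategy R S A)
    (h : history R S A) (s : S) (w : seq S) : history R S A :=
  if w is s' :: w' then play pi nu (rcons h (play_stage pi nu h s)) s' w'
  else h.

Fixpoint trajectory_prob (R : realType) (S A : finType)
    (pi : dm_strategy R S A) (nu : nature_strategy R S A)
    (h : history R S A) (s : S) (w : seq S) : R :=
  if w is s' :: w' then
    let x := play_stage pi nu h s in
    trans (stage_param x) (stage_action x) s' *
      trajectory_prob pi nu (rcons h x) s' w'
  else 1.

Definition expected_reward (R : realType) (S A : finType) (T : nat) (s1 : S)
    (pi : dm_strategy R S A) (nu : nature_strategy R S A) : R :=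
  \sum_(w : T.-tuple S)
    trajectory_prob pi nu [::] s1 w * total_reward (play pi nu [::] s1 w).

(* All trajectories from [s1]: every state sequence, against every strategy of
   the decision maker. *)
Definition admissible (R : realType) (S A : finType)
    (U : S -> set (param R S A)) (nom : S -> param R S A) (T D : nat) (s1 : S) :
    set (nature_strategy R S A) :=
  [set nu | (forall h s a, U s (nu h s a)) /\
            (forall (pi : dm_strategy R S A) (w : T.-tuple S),
               (deviations nom (play pi nu [::] s1 w) <= D)%N)].

(* Extended reals: a strategy may a priori have worst case -oo. *)
Definition worst_case (R : realType) (S A : finType)
    (U : S -> set (param R S A)) (nom : S -> param R S A) (T D : nat) (s1 : S)
    (pi : dm_strategy R S A) : \bar R :=
  ereal_inf [set (expected_reward T s1 pi nu)%:E |
             nu in admissible U nom T D s1].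

Definition feasible (R : realType) (S A : finType)
    (U : S -> set (param R S A)) (nom : S -> param R S A) (D : nat)
    (h : history R S A) (s : S) (a : A) : set (param R S A) :=
  [set u | U s u /\ (deviations nom (rcons h (Stage s a u)) <= D)%N].

(* The alternating max-min over the last [n] stages, with the expectation over
   the next state taken once (p, r) has been chosen.  Bounding the deviations
   stage by stage amounts to bounding their total, as the nominal parameters
   can always be chosen. *)
Fixpoint maxmin (R : realType) (S A : finType)
    (U : S -> set (param R S A)) (nom : S -> param R S A) (D n : nat)
    (h : history R S A) (s : S) : \bar R :=
  (if n is n'.+1 then
     \big[maxe/-oo]_(a : A)
       ereal_inf [set \sum_(s' : S)
                    (trans u a s')%:E *
                      maxmin U nom D n' (rcons h (Stage s a u)) s' |
                  u in feasible U nom D h s a]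
   else (total_reward h)%:E)%E.

Definition optimal (R : realType) (S A : finType)
    (U : S -> set (param R S A)) (nom : S -> param R S A) (T D : nat) (s1 : S)
    (pi : dm_strategy R S A) : Prop :=
  (forall pi' : dm_strategy R S A,
     (worst_case U nom T D s1 pi' <= worst_case U nom T D s1 pi)%E) /\
  worst_case U nom T D s1 pi = maxmin U nom D T [::] s1.

(* q_t(s, d, a, p, r) with [w] standing for v_{t+1}(., d). *)
Definition qval (R : realType) (S A : finType) (w : S -> R)
    (a : A) (u : param R S A) : R :=
  \sum_(s' : S) trans u a s' * w s' + reward u a.

(* The expression maximized over a in v_t(s, d), with [w] standing for
   v_{t+1}.  [inf] is the minimum when that is attained. *)
Definition objective (R : realType) (S A : finType)
    (U : S -> set (param R S A)) (nom : S -> param R S A)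
    (w : S -> nat -> R) (s : S) (d : nat) (a : A) : R :=
  if d is d'.+1 then
    Num.min (qval (w^~ d) a (nom s)) (inf [set qval (w^~ d') a u | u in U s])
  else qval (w^~ d) a (nom s).

(* [sup] is a maximum since A is finite. *)
Fixpoint value_to_go (R : realType) (S A : finType)
    (U : S -> set (param R S A)) (nom : S -> param R S A)
    (n : nat) (s : S) (d : nat) : R :=
  if n is n'.+1 then
    sup [set objective U nom (value_to_go U nom n') s d a | a in [set: A]]
  else 0.

(* v_t(s, d): there are T + 1 - t stages to go from stage t on. *)
Definition v (R : realType) (S A : finType)
    (U : S -> set (param R S A)) (nom : S -> param R S A)
    (T t : nat) (s : S) (d : nat) : R :=
  value_to_go U nom (T.+1 - t) s d.

Definition q (R : realType) (S A : finType)
    (U : S -> set (param R S A)) (nom : S -> param R S A)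
    (T t : nat) (d : nat) (a : A) (u : param R S A) : R :=
  qval ((v U nom T t.+1)^~ d) a u.

Definition markov_strategy (R : realType) (S A : finType)
    (nom : S -> param R S A) (D : nat) (astar : nat -> S -> nat -> A) :
    dm_strategy R S A :=
  fun h s => astar (size h).+1 s (D - deviations nom h)%N.

(* Main.v *)
Require Import Defs.
From mathcomp Require Import all_boot all_order all_algebra.
From mathcomp Require Import all_classical all_reals all_analysis.
Set Implicit Arguments.
Unset Strict Implicit.
Unset Printing Implicit Defensive.
Import Order.TTheory GRing.Theory Num.Theory.
Local Open Scope classical_set_scope.
Local Open Scope ring_scope.

(* Backward induction: at a history h of length t - 1 with d deviations left,
   the continuation of the game is worth the reward collected so far plus
   v_t(s, d).  The recursion charges a deviation even when the minimizer of
   q_t(s, d - 1, a, ., .) is the nominal parameter; since v_t(s, d) is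
   nonincreasing in d, Nature gains nothing from that, so the recursion does
   compute Nature's best response.  Hence the Markov strategy guarantees
   v_1(s_1, D), and the best-response strategy of Nature holds every strategy
   to v_1(s_1, D). *)

(** * Finite maxima, sums over trajectories and one-stage expectations *)

Lemma bigmaxe_max (R : realType) (I : finType) (F : I -> R) (i0 : I) :
  (forall i, F i <= F i0) ->
  (\big[maxe/-oo]_(i : I) (F i)%:E = (F i0)%:E)%E.
Proof.
move=> Fmax; apply/eqP; rewrite eq_le; apply/andP; split.
  by elim/big_ind: _ => [|x y hx hy|i _]; rewrite ?leNye ?ge_max ?hx ?lee_fin.
by rewrite (bigD1 i0) //= le_max lexx.
Qed.

(** Peels the first next state off a trajectory; [F] takes plain sequences so that it applies to
    tuples of both lengths. *)
Lemma big_tuple_cons (R : nmodType) (I : finType) (n : nat)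
    (F : seq I -> R) :
  \sum_(w : n.+1.-tuple I) F w = \sum_(i : I) \sum_(w : n.-tuple I) F (i :: w).
Proof.
rewrite pair_big /=.
rewrite (reindex (fun p : I * n.-tuple I => [tuple of p.1 :: p.2])) //=.
exists (fun w => (thead w, [tuple of behead w])) => [[i w]|w] _ /=.
  by congr pair; apply: val_inj.
by rewrite [RHS]tuple_eta.
Qed.

Lemma qval_le (R : realType) (S A : finType) (w w' : S -> R) (a : A)
    (u : param R S A) :
  stochastic u -> (forall s, w s <= w' s) -> qval w a u <= qval w' a u.
Proof.
move=> ust ww'; rewrite /qval lerD2r; apply: ler_sum => s _.
by rewrite ler_wpM2l //; case: (ust a).
Qed.

Lemma deviations_rcons (R : realType) (S A : finType) (nom : S -> param R S A)
    (h : history R S A) (x : stage R S A) :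
  deviations nom (rcons h x) =
    (deviations nom h + (stage_param x != nom (stage_state x)))%N.
Proof. by rewrite /deviations -cats1 count_cat /= addn0. Qed.

Lemma total_reward_rcons (R : realType) (S A : finType)
    (h : history R S A) (x : stage R S A) :
  total_reward (rcons h x) =
    total_reward h + reward (stage_param x) (stage_action x).
Proof. by rewrite /total_reward -cats1 big_cat big_seq1. Qed.

(** The probabilities sum to 1, so the reward already collected comes out of the expectation. *)
Lemma expected_total_qval (R : realType) (S A : finType) (h : history R S A)
    (s : S) (a : A) (u : param R S A) (w : S -> R) :
  stochastic u ->
  \sum_(s' : S) trans u a s' * (total_reward (rcons h (Stage s a u)) + w s') =
    total_reward h + qval w a u.
Proof.
move=> ust; have [_ u1] := ust a.
under eq_bigr do rewrite mulrDr.
rewrite big_split -mulr_suml u1 mul1r total_reward_rcons /qval /=.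
by rewrite -addrA [X in _ + X]addrC.
Qed.

(** * Expected reward from an arbitrary history *)

(** Extends [expected_reward] to any starting history, as induction on the remaining stages
    requires; the reward collected in [h] is included. *)
Definition reward_to_go (R : realType) (S A : finType) (n : nat)
    (pi : dm_strategy R S A) (nu : nature_strategy R S A)
    (h : history R S A) (s : S) : R :=
  \sum_(w : n.-tuple S)
    trajectory_prob pi nu h s w * total_reward (play pi nu h s w).

Lemma reward_to_go0 (R : realType) (S A : finType)
    (pi : dm_strategy R S A) (nu : nature_strategy R S A)
    (h : history R S A) (s : S) :
  reward_to_go 0 pi nu h s = total_reward h.
Proof.
rewrite /reward_to_go (bigD1 [tuple]) //= big1 ?addr0 ?mul1r // => w.
by case/eqP; exact: tuple0.
Qed.

(** Conditioning on the next state: the trajectory probability is the first transition probability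
    times that of the rest. *)
Lemma reward_to_goS (R : realType) (S A : finType) (n : nat)
    (pi : dm_strategy R S A) (nu : nature_strategy R S A)
    (h : history R S A) (s : S) :
  reward_to_go n.+1 pi nu h s =
    \sum_(s' : S) trans (nu h s (pi h s)) (pi h s) s' *
      reward_to_go n pi nu (rcons h (play_stage pi nu h s)) s'.
Proof.
rewrite /reward_to_go (@big_tuple_cons _ _ _
  (fun w => trajectory_prob pi nu h s w * total_reward (play pi nu h s w))).
apply: eq_bigr => s' _; rewrite mulr_sumr; apply: eq_bigr => w _.
by rewrite /= mulrA.
Qed.

Lemma deviations_play (R : realType) (S A : finType) (nom : S -> param R S A)
    (pi : dm_strategy R S A) (nu : nature_strategy R S A)
    (h : history R S A) (s : S) (w : seq S) :
  (deviations nom h <= deviations nom (play pi nu h s w))%N.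
Proof.
elim: w h s => //= s' w IH h s; apply: leq_trans (IH _ _).
by rewrite deviations_rcons leq_addr.
Qed.

(** * The recursion and Nature's one-stage problem *)

Section DeviationBudget.
Variables (R : realType) (S A : finType).
Variables (U : S -> set (param R S A)) (nom : S -> param R S A) (T D : nat).
Variable astar : nat -> S -> nat -> A.
Hypothesis U_stochastic : forall (s : S) (u : param R S A),
  U s u -> stochastic u.
Hypothesis nom_in_U : forall s : S, U s (nom s).

Local Notation V := (value_to_go U nom).

(** Here [n] counts the stages left after stage t = [T - n], so [V n] is v_{t+1}; [d] is the budget
    left after a deviation, hence [d < D]. *)
Hypothesis min_attained : forall (n : nat) (s : S) (d : nat) (a : A),
  (n < T)%N -> (d < D)%N ->
  exists2 u : param R S A, U s u &
    forall u' : param R S A, U s u' ->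
      qval ((V n)^~ d) a u <= qval ((V n)^~ d) a u'.
Hypothesis astar_argmax : forall (n : nat) (s : S) (d : nat),
  (n < T)%N -> (d <= D)%N ->
  forall a : A,
    objective U nom (V n) s d a <= objective U nom (V n) s d (astar (T - n) s d).

Lemma value_to_goS (n : nat) (s : S) (d : nat) :
  (n < T)%N -> (d <= D)%N ->
  V n.+1 s d = objective U nom (V n) s d (astar (T - n) s d).
Proof.
move=> nT dD /=; have ub := @astar_argmax n s d nT dD.
apply/eqP; rewrite eq_le; apply/andP; split.
  by apply: ge_sup => [|_ [a _ <-] //]; exists (objective U nom (V n) s d
    (astar (T - n) s d)), (astar (T - n) s d).
apply: ub_le_sup; last by exists (astar (T - n) s d).
by eexists => _ [a _ <-]; exact: ub.
Qed.

Lemma inf_qval_attained (n : nat) (s : S) (d : nat) (a : A) :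
  (n < T)%N -> (d < D)%N ->
  exists2 u : param R S A, U s u &
    qval ((V n)^~ d) a u = inf [set qval ((V n)^~ d) a u | u in U s].
Proof.
move=> nT dD; have [u Uu umin] := @min_attained n s d a nT dD; exists u => //.
apply/eqP; rewrite eq_le; apply/andP; split.
  apply: lb_le_inf; first by exists (qval ((V n)^~ d) a u), u.
  by move=> _ [u' Uu' <-]; exact: umin.
apply: ge_inf; last by exists u.
by exists (qval ((V n)^~ d) a u) => _ [u' Uu' <-]; exact: umin.
Qed.

Lemma inf_qval_le (n : nat) (s : S) (d : nat) (a : A) (u : param R S A) :
  (n < T)%N -> (d < D)%N -> U s u ->
  inf [set qval ((V n)^~ d) a u | u in U s] <= qval ((V n)^~ d) a u.
Proof.
move=> nT dD Uu; have [u0 _ u0min] := @min_attained n s d a nT dD.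
apply: ge_inf; last by exists u.
by exists (qval ((V n)^~ d) a u0) => _ [u' Uu' <-]; exact: u0min.
Qed.

Lemma value_to_go_antitone (n : nat) (s : S) (d : nat) :
  (n <= T)%N -> (d < D)%N -> V n s d.+1 <= V n s d.
Proof.
elim: n s d => [//|n IH] s d nT dD.
rewrite value_to_goS // [leRHS]value_to_goS ?(ltnW dD) //.
(* The action optimal for [d.+1] is also a candidate for [d], so it suffices to compare the two
   objectives at this one action. *)
apply: le_trans (@astar_argmax n s d nT (ltnW dD) (astar (T - n) s d.+1)).
move: (astar _ _ _) => a.
have IHq u d' : U s u -> (d' < D)%N ->
    qval ((V n)^~ d'.+1) a u <= qval ((V n)^~ d') a u.
  move=> Uu d'D; apply: qval_le => [|s']; first exact: U_stochastic Uu.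
  exact: IH (ltnW nT) d'D.
case: d => [|d] in dD *; first by rewrite /= ge_min IHq //; exact: nom_in_U.
rewrite /= le_min !ge_min (IHq _ _ (nom_in_U s) dD) /=; apply/orP; right.
(* The minimizer for the smaller budget is tried against the larger one. *)
have [u Uu <-] := @inf_qval_attained n s d a nT (ltnW dD).
exact: le_trans (inf_qval_le _ nT dD Uu) (IHq _ _ Uu (ltnW dD)).
Qed.

(** A nominal [u] is bounded through the first term of the minimum, any other through the infimum.
    Here a deviation is charged only when [u] really differs from the nominal value. *)
Lemma objective_le (n : nat) (s : S) (d : nat) (a : A) (u : param R S A) :
  (n < T)%N -> (d <= D)%N -> U s u -> ((u != nom s) <= d)%N ->
  objective U nom (V n) s d a <= qval ((V n)^~ (d - (u != nom s))%N) a u.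
Proof.
move=> nT dD Uu; have [-> _|] := eqVneq u (nom s).
  by rewrite subn0; case: d => [|d] in dD *; rewrite /= ?ge_min lexx.
case: d dD => // d dD _ _; rewrite subn1 /= ge_min inf_qval_le ?orbT //.
Qed.

(** The witness is the nominal parameter, ties included, or else the minimizer for one deviation
    less, which is then strictly better. *)
Lemma objective_attained (n : nat) (s : S) (d : nat) (a : A) :
  (n < T)%N -> (d <= D)%N ->
  exists u : param R S A,
    [/\ U s u, ((u != nom s) <= d)%N &
        qval ((V n)^~ (d - (u != nom s))%N) a u = objective U nom (V n) s d a].
Proof.
move=> nT; case: d => [|d] dD; first by exists (nom s); rewrite eqxx.
have [u Uu uE] := @inf_qval_attained n s d a nT dD.
have [le|lt] := leP (qval ((V n)^~ d.+1) a (nom s)) (qval ((V n)^~ d) a u).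
  by exists (nom s); rewrite eqxx subn0 /= -uE min_l.
exists u; rewrite (leq_trans (leq_b1 _)) //= -uE min_r ?ltW //; split => //.
have [unom|_] := eqVneq u (nom s); last by rewrite subn1.
(* A nominal minimizer is excluded: not charging it a deviation could only
   lower its q-value. *)
move: lt; rewrite -unom ltNge => /negP[]; apply: qval_le => [|s'].
  exact: U_stochastic Uu.
exact: value_to_go_antitone (ltnW nT) dD.
Qed.

(** * Value of the nested max-min, and guarantees for both players *)

Lemma maxmin_value_to_go (n : nat) (h : history R S A) (s : S) :
  (size h + n)%N = T -> (deviations nom h <= D)%N ->
  maxmin U nom D n h s =
    (total_reward h + V n s (D - deviations nom h)%N)%:E.
Proof.
elim: n h s => [|n IH] h s hT hD; first by rewrite /= addr0.
have nT : (n < T)%N by rewrite -hT addnS ltnS leq_addl.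
set d := (D - deviations nom h)%N; have dD : (d <= D)%N by exact: leq_subr.
rewrite value_to_goS //=.
under eq_bigr => a _.
  suff -> : ereal_inf [set (\sum_(s' : S) (trans u a s')%:E *
        maxmin U nom D n (rcons h (Stage s a u)) s')%E
      | u in feasible U nom D h s a] =
      (total_reward h + objective U nom (V n) s d a)%:E by over.
  (* Feasibility of [u] keeps the extended history within the budget, so the induction hypothesis
     applies to it. *)
  have sumE u : feasible U nom D h s a u ->
      (\sum_(s' : S) (trans u a s')%:E *
        maxmin U nom D n (rcons h (Stage s a u)) s')%E =
      (total_reward h + qval ((V n)^~ (d - (u != nom s))%N) a u)%:E.
    move=> [Uu devu].
    under eq_bigr do rewrite IH ?size_rcons ?addSnnS // -EFinM.
    rewrite sumEFin deviations_rcons /= subnDA.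
    by rewrite expected_total_qval //; exact: U_stochastic Uu.
  have feasE u : feasible U nom D h s a u <-> U s u /\ ((u != nom s) <= d)%N.
    by rewrite /feasible /= deviations_rcons /= -leq_subRL.
  apply/eqP; rewrite eq_le; apply/andP; split.
    have [u [Uu ud uE]] := @objective_attained n s d a nT dD.
    apply: ereal_inf_lbound; exists u; first by apply/feasE.
    by rewrite sumE ?uE //; apply/feasE.
  apply: le_ereal_inf_tmp => _ [u fu <-]; rewrite sumE // lee_fin lerD2l.
  by move/feasE: fu => [Uu ud]; exact: objective_le.
apply: (@bigmaxe_max _ _ (fun a => total_reward h + objective U nom (V n) s d a))
  => a.
by rewrite lerD2l; exact: astar_argmax.
Qed.

Lemma markov_strategy_guarantee (n : nat) (nu : nature_strategy R S A)
    (h : history R S A) (s : S) :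
  (forall h s a, U s (nu h s a)) -> (size h + n)%N = T ->
  (forall w, size w = n ->
    (deviations nom (play (markov_strategy nom D astar) nu h s w) <= D)%N) ->
  total_reward h + V n s (D - deviations nom h)%N <=
    reward_to_go n (markov_strategy nom D astar) nu h s.
Proof.
move=> Unu; elim: n h s => [|n IH] h s hT hD.
  by rewrite reward_to_go0 addr0.
have nT : (n < T)%N by rewrite -hT addnS ltnS leq_addl.
set pi := markov_strategy nom D astar in IH hD *.
set u := nu h s (pi h s).
have devu : (deviations nom (rcons h (play_stage pi nu h s)) <= D)%N.
  (* Any continuation of the right length serves: the deviation count never decreases, so the final
     bound also holds after this stage. *)
  have := hD (nseq n.+1 s) (size_nseq _ _).
  by apply: leq_trans; rewrite /= deviations_play.
rewrite reward_to_goS.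
apply: (@le_trans _ _ (\sum_(s' : S) trans u (pi h s) s' *
    (total_reward (rcons h (Stage s (pi h s) u)) +
     V n s' (D - deviations nom (rcons h (Stage s (pi h s) u)))%N))).
  have ust : stochastic u by exact: U_stochastic (Unu _ _ _).
  rewrite expected_total_qval // lerD2l value_to_goS ?leq_subr //.
  (* The current stage number [(size h).+1] equals [T - n]. *)
  have -> : astar (T - n) s (D - deviations nom h) = pi h s.
    by rewrite /pi /markov_strategy -hT addnS -addSn addnK.
  move: devu; rewrite !deviations_rcons /= -/u => devu.
  rewrite subnDA; apply: objective_le => //; [exact: leq_subr|exact: Unu|].
  by rewrite leq_subRL // (leq_trans _ devu) ?leq_addr.
apply: ler_sum => s' _; apply: ler_wpM2l.
  by have [] := U_stochastic (Unu h s (pi h s)) (pi h s).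
apply: IH => [|w wn]; first by rewrite size_rcons addSnnS.
exact: (hD (s' :: w)) (congr1 _ wn).
Qed.

(** Nature sees the action before choosing, so a single strategy, picked pointwise from
    [objective_attained], answers every [pi]. *)
Lemma best_response_exists :
  exists nu : nature_strategy R S A,
    [/\ forall h s a, U s (nu h s a),
        forall pi h s w, (deviations nom h <= D)%N ->
          (deviations nom (play pi nu h s w) <= D)%N &
        forall pi n h s, (size h + n)%N = T -> (deviations nom h <= D)%N ->
          reward_to_go n pi nu h s <=
            total_reward h + V n s (D - deviations nom h)%N].
Proof.
have /choice[f fP] (x : history R S A * S * A) : exists u : param R S A,
    let: (h, s, a) := x in let d := (D - deviations nom h)%N in
    [/\ U s u, ((u != nom s) <= d)%N &
        forall n, (size h + n.+1)%N = T ->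
          qval ((V n)^~ (d - (u != nom s))%N) a u = objective U nom (V n) s d a].
  (* The length of [h] determines [n]. Histories of length at least [T] lie beyond the game and get
     the nominal parameter as a default. *)
  case: x => [[h s] a] /=; case: (leqP T (size h)) => hT.
    exists (nom s); rewrite eqxx; split => // n hn.
    by move: hT; rewrite -hn addnS ltnNge leq_addr.
  have [|u [Uu ud uE]] := @objective_attained (T - (size h).+1) s
    (D - deviations nom h) a _ (leq_subr _ _).
    by rewrite ltn_subrL (leq_ltn_trans (leq0n _) hT).
  by exists u; split => // n; rewrite -addSnnS => hn; move: uE; rewrite -hn addKn.
pose nu : nature_strategy R S A := fun h s a => f (h, s, a).
have nuD pi h s : (deviations nom h <= D)%N ->
    (deviations nom (rcons h (play_stage pi nu h s)) <= D)%N.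
  move=> hD; rewrite deviations_rcons -leq_subRL //.
  by have [] := fP (h, s, pi h s).
exists nu; split => [h s a|pi h s w|pi n h s].
- by have [] := fP (h, s, a).
- by elim: w h s => //= s' w IH h s hD; exact/IH/nuD.
elim: n h s => [|n IH] h s hT hD; first by rewrite reward_to_go0 addr0.
have nT : (n < T)%N by rewrite -hT addnS ltnS leq_addl.
have [/U_stochastic ust _ /(_ n hT) uE] := fP (h, s, pi h s).
rewrite reward_to_goS.
(* The intermediate value is the objective at the action actually played, which is at most the one
   at [astar]. *)
apply: le_trans (_ : _ <= total_reward h +
    objective U nom (V n) s (D - deviations nom h) (pi h s)) _; last first.
  by rewrite lerD2l value_to_goS ?leq_subr //; apply: astar_argmax;
    rewrite ?leq_subr.
rewrite -uE -subnDA -(@expected_total_qval _ _ _ _ s) //; apply: ler_sum => s' _.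
apply: ler_wpM2l; first by have [] := ust (pi h s).
have := IH (rcons h (play_stage pi nu h s)) s'.
by rewrite deviations_rcons /= size_rcons addSnnS => /(_ hT); apply;
  have := nuD pi h s hD; rewrite deviations_rcons.
Qed.

End DeviationBudget.

Theorem theorem5 (R : realType) (S A : finType)
  (U : S -> set (param R S A)) (nom : S -> param R S A)
  (T D : nat) (s1 : S) (astar : nat -> S -> nat -> A)
  (U_convex : forall s : S, convex_params (U s))
  (U_stochastic : forall (s : S) (u : param R S A), U s u -> stochastic u)
  (nom_in_U : forall s : S, U s (nom s))
  (min_attained : forall (t : nat) (s : S) (d : nat) (a : A),
     (1 <= t <= T)%N -> (1 <= d <= D)%N ->
     exists2 u : param R S A, U s u &
       forall u' : param R S A, U s u' ->
         q U nom T t d.-1 a u <= q U nom T t d.-1 a u')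
  (astar_argmax : forall (t : nat) (s : S) (d : nat),
     (1 <= t <= T)%N -> (d <= D)%N ->
     forall a : A,
       objective U nom (v U nom T t.+1) s d a <=
       objective U nom (v U nom T t.+1) s d (astar t s d)) :
  optimal U nom T D s1 (markov_strategy nom D astar).
Proof.
(* Translates between stage t and the number [n] = T - t of stages after it. *)
have stageE n : (n < T)%N -> (1 <= T - n <= T)%N /\
    v U nom T (T - n).+1 = value_to_go U nom n.
  move=> nT; rewrite subn_gt0 nT leq_subr; split=> //.
  by rewrite /v subSS subKn // ltnW.
have mina n s d a : (n < T)%N -> (d < D)%N -> exists2 u, U s u &
    forall u', U s u' -> qval ((value_to_go U nom n)^~ d) a u <=
                         qval ((value_to_go U nom n)^~ d) a u'.
  move=> /stageE[tT vE] dD.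
  (* The theorem indexes by the budget before the deviation, hence [d.+1]. *)
  by have := @min_attained _ s d.+1 a tT dD; rewrite /q vE.
have amax n s d : (n < T)%N -> (d <= D)%N -> forall a,
    objective U nom (value_to_go U nom n) s d a <=
    objective U nom (value_to_go U nom n) s d (astar (T - n)%N s d).
  move=> /stageE[tT vE] dD a.
  by have := @astar_argmax _ s d tT dD a; rewrite vE.
set val := value_to_go U nom T s1 D.
have [nu [Unu devnu nu_le]] :=
  best_response_exists U_stochastic nom_in_U mina amax.
have worst_le pi : (worst_case U nom T D s1 pi <= val%:E)%E.
  (* The best response is admissible, so it bounds the infimum for every [pi]. *)
  apply: ge_ereal_inf; exists (expected_reward T s1 pi nu)%:E.
    by exists nu => //; split => // pi' w; exact: devnu.
  rewrite lee_fin; have := nu_le pi T [::] s1 (add0n _) (leq0n _).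
  by rewrite subn0 /total_reward big_nil add0r.
have worst_markov : worst_case U nom T D s1 (markov_strategy nom D astar) = val%:E.
  apply/eqP; rewrite eq_le worst_le /=.
  apply: le_ereal_inf_tmp => _ [nu' [Unu' devnu'] <-]; rewrite lee_fin.
  have := markov_strategy_guarantee U_stochastic mina amax (n := T)
    (s := s1) (h := [::]) Unu' (add0n _).
  rewrite subn0 /total_reward big_nil add0r; apply=> w /eqP wT.
  exact: (devnu' _ (Tuple wT)).
split=> [pi'|]; first by rewrite worst_markov.
rewrite worst_markov (maxmin_value_to_go U_stochastic nom_in_U
  mina amax) //.
by rewrite subn0 /total_reward big_nil add0r.
Qed.
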